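(* Let $d\ge2$ be a constant and $\phi\ge1$. Consider Manhattan ($L_1$) TSP instances with $n$ vertices $v_1,\ldots,v_n\in[0,1]^d$, where for every vertex $v_i$ and every $j\in[d]$ the $j$-th coordinate of $v_i$ is drawn according to a density $f_i^j\colon[0,1]\to[0,\phi]$, all $dn$ coordinates being drawn independently. Starting with an arbitrary tour, the expected number of steps performed by 2-Opt on such instances is $O(n^6\cdot\log n\cdot\phi)$.
   Context: 2-Opt starts from a tour and repeatedly performs improving 2-changes (replace tour edges $\{u_1,u_2\},\{v_1,v_2\}$, with $u_1,u_2,v_1,v_2$ distinct and in this order along the tour, by $\{u_1,v_1\},\{u_2,v_2\}$, provided the tour length strictly decreases) until none exists; the bound holds for any initial tour and any choice of improving steps. $O$-notation hides constants depending on $d$. *)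

(* Defs.v *)
From HB Require Import structures.
From mathcomp Require Import all_boot all_order all_algebra.
From mathcomp Require Import all_classical all_reals all_analysis.

Set Implicit Arguments.
Unset Strict Implicit.
Unset Printing Implicit Defensive.

Import Order.TTheory GRing.Theory Num.Theory.

Local Open Scope ring_scope.

Definition manhattan (R : realType) (d : nat) (x y : 'rV[R]_d) : R :=
  \sum_(j < d) `|x ord0 j - y ord0 j|.

(** Tours on the vertex set 'I_n are undirected Hamiltonian cycles, represented
    by their edge sets. *)

Definition edge_set (n : nat) : Type := {set {set 'I_n}}.

(* [next s x] is the cyclic successor of [x] in [s]. *)
Definition tour_edges (n : nat) (s : n.-tuple 'I_n) : edge_set n :=
  [set [set x; next s x] | x : 'I_n]%SET.

Definition is_tour (n : nat) (E : edge_set n) : Prop :=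
  exists2 s : n.-tuple 'I_n, uniq s & E = tour_edges s.

(* The visiting order [s] of [E] can be started anywhere and in either
   direction, so the pattern below loses no generality; the four vertices are
   distinct because [s] is duplicate-free. *)
Definition two_change (n : nat) (E E' : edge_set n) : Prop :=
  exists (s : n.-tuple 'I_n) (u1 u2 v1 v2 : 'I_n) (p q : seq 'I_n),
    [/\ uniq s,
        E = tour_edges s,
        tval s = [:: u1, u2 & p ++ [:: v1, v2 & q]] &
        E' = (E :\: [set [set u1; u2]; [set v1; v2]]
                :|: [set [set u1; v1]; [set u2; v2]])%SET].

(* For a symmetric [dist], the summand at the edge {x, y}, x != y, is
   [dist x y]. *)
Definition tour_length (R : realType) (n : nat) (dist : 'I_n -> 'I_n -> R)
    (E : edge_set n) : R :=
  \sum_(e in E) \sum_(x in e) \sum_(y in e | (x < y)%N) dist x y.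

Definition improving_step (R : realType) (n : nat) (dist : 'I_n -> 'I_n -> R)
    (E E' : edge_set n) : Prop :=
  two_change E E' /\ tour_length dist E' < tour_length dist E.

(* An execution from the initial tour [E] visiting successively the tours of
   [s]; it performs [size s] steps. *)
Definition two_opt_run (R : realType) (n : nat) (dist : 'I_n -> 'I_n -> R)
    (E : edge_set n) (s : seq (edge_set n)) : Prop :=
  [/\ is_tour E,
      path (fun F F' => `[< improving_step dist F F' >]) E s &
      forall E', ~ improving_step dist (last E s) E'].

Local Open Scope classical_set_scope.

(* Worst case over all initial tours and all choices of improving steps. As a
   function of a random instance it is measurable: it depends only on the
   outcomes of finitely many comparisons of tour lengths. *)
Definition two_opt_steps (R : realType) (n : nat) (dist : 'I_n -> 'I_n -> R) :
    \bar R :=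
  ereal_sup [set ((size s)%:R)%:E | s in
               [set s | exists E : edge_set n, two_opt_run dist E s]].

Definition bounded_density (R : realType) (phi : R) (f : R -> R) : Prop :=
  measurable_fun (`[0, 1] : set R) f /\
  forall x, 0 <= x <= 1 -> 0 <= f x <= phi.

(* [X] is drawn according to [f] restricted to [0, 1]; with [A := setT] this
   forces [f] to have integral 1 over [0, 1]. *)
Definition drawn_from (disp : measure_display) (Omega : measurableType disp)
    (R : realType) (P : probability Omega R) (X : {RV P >-> R})
    (f : R -> R) : Prop :=
  forall A : set R, measurable A ->
    (distribution P X A =
     \int[lebesgue_measure]_(x in A `&` `[0%R, 1%R]) (f x)%:E)%E.

Definition mutually_independent (disp : measure_display)
    (Omega : measurableType disp) (R : realType) (P : probability Omega R)
    (I : finType) (X : I -> {RV P >-> R}) : Prop :=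
  forall (J : {set I}) (A : I -> set R), (forall i, measurable (A i)) ->
    (P (\bigcap_(i in [set` J]) (X i @^-1` A i)) =
     \prod_(i in J) P (X i @^-1` A i))%E.

(* Main.v *)
(** A run of [T] steps decreases the tour length, which is at most [n * d] when
    all coordinates lie in [0, 1], [T] times; hence some 2-change has gain in
    ]0, n d / T]. For fixed signs of the coordinate differences, the gain of a
    2-change is a linear form in the coordinates with integer coefficients. If
    all coefficients vanish, so does the gain; otherwise one coordinate, of
    density at most [phi] and independent of the others, has a coefficient of
    absolute value at least 1, so that the gain lies in ]0, eps] with
    probability O(phi eps). A union bound over the [n ^ 4] 2-changes and the
    [16 ^ d] sign patterns gives P(T >= t) = O(n^5 phi / t). Since every step
    leaves a new tour, T <= n ^ n, and summing over t contributes the factor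
    1 + ln (n ^ n). *)

Require Import Defs.
From HB Require Import structures.
From mathcomp Require Import all_boot all_order all_algebra.
From mathcomp Require Import all_classical all_reals all_analysis.
From mathcomp Require Import measurable_realfun ring lra.
Set Implicit Arguments.
Unset Strict Implicit.
Unset Printing Implicit Defensive.
Import Order.TTheory GRing.Theory Num.Theory.
Local Open Scope ring_scope.

(** * Lengths of tours, gains of 2-changes and lengths of runs *)

Lemma set2_eq_cases (T : finType) (a b x y : T) :
  [set a; b]%SET = [set x; y]%SET -> a != b ->
  (x = a /\ y = b) \/ (x = b /\ y = a).
Proof.
move=> e ab.
have := set21 a b; rewrite e => /set2P[ax|ay].
  left; split=> //; have := set22 a b; rewrite e => /set2P[bx|//].
  by rewrite ax bx eqxx in ab.
right; split=> //; have := set22 a b; rewrite e => /set2P[//|by_].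
by rewrite ay by_ eqxx in ab.
Qed.

Definition edge_length (R : realType) (n : nat) (dist : 'I_n -> 'I_n -> R)
    (e : {set 'I_n}) : R :=
  \sum_(x in e) \sum_(y in e | (x < y)%N) dist x y.

Lemma edge_length_set2 (R : realType) (n : nat) (dist : 'I_n -> 'I_n -> R)
    (x y : 'I_n) :
  (forall i j, dist i j = dist j i) -> x != y ->
  edge_length dist [set x; y]%SET = dist x y.
Proof.
move=> sym.
wlog lt_xy : x y / (x < y)%N.
  move=> H xy; have := xy; rewrite -val_eqE neq_ltn => /orP[lt|lt].
    exact: H.
  by rewrite finset.setUC sym; apply: H => //; rewrite eq_sym.
move=> xy; rewrite /edge_length big_setU1 ?inE//= big_set1.
rewrite !big_mkcondr/= !big_setU1 ?inE//= !big_set1 lt_xy !ltnn.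
by rewrite ltnNge (ltnW lt_xy)/= !add0r !addr0.
Qed.

Lemma edge_length_set2_le (R : realType) (n : nat) (dist : 'I_n -> 'I_n -> R)
    (B : R) (x y : 'I_n) :
  (forall i j, dist i j = dist j i) -> (forall i j, 0 <= dist i j <= B) ->
  edge_length dist [set x; y]%SET <= B.
Proof.
move=> sym dB; have [<-|xy] := eqVneq x y; last first.
  by rewrite edge_length_set2//; have /andP[] := dB x y.
(* The degenerate pair [x = y], as in a one-vertex tour, has length 0; [dB x x] yields [0 <= B]. *)
rewrite finset.setUid /edge_length big_set1 big_mkcondr/= big_set1 ltnn.
by have /andP[] := dB x x; apply: le_trans.
Qed.

Lemma tour_length_ge0 (R : realType) (n : nat) (dist : 'I_n -> 'I_n -> R)
    (E : edge_set n) :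
  (forall i j, 0 <= dist i j) -> 0 <= tour_length dist E.
Proof. by move=> d0; do 3!apply: sumr_ge0 => ? _. Qed.

Lemma tour_length_le (R : realType) (n : nat) (dist : 'I_n -> 'I_n -> R)
    (B : R) (E : edge_set n) :
  (forall i j, dist i j = dist j i) -> (forall i j, 0 <= dist i j <= B) ->
  is_tour E -> tour_length dist E <= n%:R * B.
Proof.
move=> sym dB [s _ ->].
have [n0|n0] := posnP n.
  by subst n; rewrite mul0r /tour_length big1// => e /imsetP[[]].
have B0 : 0 <= B.
  by have /andP[] := dB (Ordinal n0) (Ordinal n0); apply: le_trans.
apply: (@le_trans _ _ (\sum_(e in tour_edges s) B)).
  by apply: ler_sum => e /imsetP[x _ ->]; apply: edge_length_set2_le.
rewrite sumr_const -[B *+ _]mulr_natl ler_wpM2r// ler_nat.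
by rewrite -[leqRHS]card_ord; apply: leq_imset_card.
Qed.

(** Defined for all quadruples, coinciding vertices included, so that the union bound can range over
    a plain product type. *)
Definition gain (R : realType) (n : nat) (dist : 'I_n -> 'I_n -> R)
    (q : 'I_n * 'I_n * 'I_n * 'I_n) : R :=
  let: (u1, u2, v1, v2) := q in
  dist u1 u2 + dist v1 v2 - dist u1 v1 - dist u2 v2.

Lemma next_cat2 (T : eqType) (p q : seq T) (x y : T) :
  uniq (p ++ [:: x, y & q]) -> next (p ++ [:: x, y & q]) x = y.
Proof.
move=> us; rewrite next_nth mem_cat mem_head orbT.
have xp : x \notin p.
  by move: us; rewrite cat_uniq /= negb_or => /and3P[_ /andP[]].
rewrite index_cat (negbTE xp) /= eqxx addn0.
by case: p {us xp} => [|z p] //=; rewrite nth_cat ltnNge leqnSn subSnn.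
Qed.

(** Tours are edge sets, so the lengths subtract as expected only because the two removed edges are
    distinct members of [E] and the two inserted ones are distinct and absent from [E]. *)
Lemma two_change_gain (R : realType) (n : nat) (dist : 'I_n -> 'I_n -> R)
    (E E' : edge_set n) :
  (forall i j, dist i j = dist j i) -> two_change E E' ->
  exists q, tour_length dist E - tour_length dist E' = gain dist q.
Proof.
move=> sym [s [u1 [u2 [v1 [v2 [p [q [us -> es ->]]]]]]]] {E E'}.
exists (u1, u2, v1, v2); rewrite /gain.
have nu : next s u1 = u2.
  by move: us; rewrite es -(cat0s (u1 :: _)); apply: next_cat2.
have nv : next s v1 = v2.
  by move: us; rewrite es -!cat_cons; apply: next_cat2.
have inj_next : injective (next s) by exact: can_inj (prev_next us).
have := us; rewrite es /= !inE !mem_cat !inE !negb_or -!andbA cat_uniq /=.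
rewrite !inE !negb_or -!andbA.
move=> /and5P[u12 _ u1v1 u1v2 /and5P[_ _ u2v1 u2v2 /and5P[_ _ _ _]]].
move=> /and4P[_ v12 _ _].
set E := tour_edges s.
pose e1 := [set u1; u2]%SET; pose e2 := [set v1; v2]%SET.
pose e3 := [set u1; v1]%SET; pose e4 := [set u2; v2]%SET.
have e12 : e1 != e2.
  apply/eqP => e; have := set21 u1 u2.
  by rewrite -/e1 e !inE (negbTE u1v1) (negbTE u1v2).
have e34 : e3 != e4.
  apply/eqP => e; have := set21 u1 v1.
  by rewrite -/e3 e !inE (negbTE u12) (negbTE u1v2).
have e1E : e1 \in E by apply/imsetP; exists u1; rewrite ?nu.
have e2E : e2 \in E by apply/imsetP; exists v1; rewrite ?nv.
have e3E : e3 \notin E.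
  apply/imsetP => -[x _ /set2_eq_cases /(_ u1v1) [] [-> e]].
    by move: u2v1; rewrite -nu e eqxx.
  by move: u1v2; rewrite -nv e eqxx.
(* Here the successor of [u2] or of [v2] is not known explicitly; injectivity of [next s] reduces to
   the known successors of [v1] and [u1]. *)
have e4E : e4 \notin E.
  apply/imsetP => -[x _ /set2_eq_cases /(_ u2v2) [] [-> e]].
    by move: u2v1; rewrite (inj_next u2 v1) ?eqxx// e.
  by move: u1v2; rewrite (inj_next u1 v2) ?eqxx// e.
have lenE : tour_length dist E =
    edge_length dist e1 + edge_length dist e2 +
    \sum_(e in E :\: [set e1; e2]) edge_length dist e.
  rewrite /tour_length (big_setID [set e1; e2]%SET) /=; congr (_ + _).
  have -> : (E :&: [set e1; e2] = [set e1; e2])%SET.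
    apply/finset.setIidPr/fintype.subsetP => e /set2P[] -> //.
  by rewrite big_setU1 ?inE//= big_set1.
have lenE' : tour_length dist (E :\: [set e1; e2] :|: [set e3; e4])%SET =
    \sum_(e in E :\: [set e1; e2]) edge_length dist e +
    (edge_length dist e3 + edge_length dist e4).
  rewrite /tour_length.
  rewrite (eq_bigl [predU (E :\: [set e1; e2])%SET & [set e3; e4]%SET]);
    last by move=> e; rewrite !inE.
  rewrite bigU /=; last first.
    rewrite disjoint_subset; apply/fintype.subsetP => e; rewrite !inE.
    move=> /andP[_ eE]; rewrite negb_or; apply/andP; split;
      by apply: contraTneq eE => ->.
  by congr (_ + _); rewrite big_setU1 ?inE//= big_set1.
rewrite lenE lenE' !edge_length_set2//; ring.
Qed.

(** The length strictly decreases, so no tour recurs, and every tour that a step leaves is the edge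
    set of one of the [n ^ n] tuples. *)
Lemma improving_path_size (R : realType) (n : nat) (dist : 'I_n -> 'I_n -> R)
    (E : edge_set n) (s : seq (edge_set n)) :
  path (fun F F' => `[< improving_step dist F F' >]) E s -> (size s <= n ^ n)%N.
Proof.
move=> ps.
have uniq_run : uniq (E :: s).
  apply: (@sorted_uniq _
    (fun F F' => tour_length dist F' < tour_length dist F)).
  - by move=> F G H /[swap]; apply: lt_trans.
  - by move=> F; rewrite ltxx.
  - by apply: sub_path ps => F F' /asboolP[].
(* A 2-change exhibits a visiting order of its source but not of its result, so the last tour is
   dropped; [belast E s] still has [size s] elements. *)
have sub_tours : {subset belast E s <=
    [seq tour_edges t | t <- enum {: n.-tuple 'I_n}]}.
  elim: s E ps {uniq_run} => [|F s IH] E //= /andP[/asboolP[EF _] ps] G.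
  rewrite inE => /predU1P[->|]; last exact: IH.
  by have [t [? [? [? [? [? [? [_ -> _ _]]]]]]]] := EF; rewrite map_f ?mem_enum.
rewrite -(size_belast E) -[leqRHS](_ :
  size [seq tour_edges t | t <- enum {: n.-tuple 'I_n}] = _).
  apply: uniq_leq_size sub_tours.
  by move: uniq_run; rewrite lastI rcons_uniq => /andP[].
by rewrite size_map -cardE card_tuple card_ord.
Qed.

Lemma improving_path_gain (R : realType) (n : nat) (dist : 'I_n -> 'I_n -> R)
    (delta : R) (E : edge_set n) (s : seq (edge_set n)) :
  (forall i j, dist i j = dist j i) ->
  (forall q, 0 < gain dist q -> delta < gain dist q) ->
  path (fun F F' => `[< improving_step dist F F' >]) E s -> (0 < size s)%N ->
  (size s)%:R * delta < tour_length dist E - tour_length dist (last E s).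
Proof.
move=> sym large.
have step F F' : improving_step dist F F' ->
    delta < tour_length dist F - tour_length dist F'.
  move=> [/(two_change_gain sym)[q eq_q]]; rewrite -subr_gt0 eq_q.
  exact: large.
(* The strict inequality fails for the empty run, so the induction starts from a single step. *)
elim: s E => [//|F [|G s] IH] E /= /andP[/asboolP/step EF ps] _.
  by rewrite mul1r.
have := IH F ps isT.
rewrite -[(size (G :: s)).+1]add1n natrD mulrDl mul1r /=; lra.
Qed.

(** Otherwise each of the at least [t] steps would gain more than [n * B / t], in total more than
    the initial length, and the final length would be negative. *)
Lemma two_opt_run_small_gain (R : realType) (n : nat)
    (dist : 'I_n -> 'I_n -> R) (B : R) (E : edge_set n)
    (s : seq (edge_set n)) (t : nat) :
  (forall i j, dist i j = dist j i) -> (forall i j, 0 <= dist i j <= B) ->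
  two_opt_run dist E s -> (0 < t <= size s)%N ->
  exists q, 0 < gain dist q <= n%:R * B / t%:R.
Proof.
move=> sym dB [tE ps _] /andP[t0 ts].
apply: contrapT => noq.
have large q : 0 < gain dist q -> n%:R * B / t%:R < gain dist q.
  move=> q0; rewrite ltNge; apply/negP => ql.
  by apply: noq; exists q; rewrite q0.
have d0 i j : 0 <= dist i j by have /andP[] := dB i j.
have := improving_path_gain sym large ps (leq_trans t0 ts).
have := tour_length_ge0 (last E s) d0.
have := tour_length_ge0 E d0.
have := tour_length_le sym dB tE.
set D := n%:R * B => ED E0 l0.
have : D <= (size s)%:R * (D / t%:R).
  rewrite mulrCA ler_peMr ?(le_trans E0)//.
  by rewrite ler_pdivlMr ?ltr0n// mul1r ler_nat.
lra.
Qed.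

(** * Monotonicity of the integral, union bound, mass of an interval under a bounded density *)

Local Open Scope classical_set_scope.

(** The integral of a nonnegative function is a supremum over the simple functions below it, hence
    monotone by inclusion. This bounds the expectation of [two_opt_steps] directly by that of a sum
    of indicators. *)
Lemma le_integral_ge0_bound (disp : measure_display)
    (T : measurableType disp) (R : realType)
    (mu : {measure set T -> \bar R}) (f g : T -> \bar R) :
  (forall x, 0 <= g x)%E -> (forall x, f x <= g x)%E ->
  (\int[mu]_x f x <= \int[mu]_x g x)%E.
Proof.
move=> g0 fg; rewrite integralE.
apply: (@le_trans _ _ (\int[mu]_x (f^\+ x)%E)%E).
  by rewrite geeDl// oppe_le0 integral_ge0.
rewrite !ge0_integralTE//.
apply: le_ereal_sup => _ [h hf <-]; exists h => // x.
by apply: (le_trans (hf x)); rewrite funeposE ge_max fg g0.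
Qed.

Lemma measure_bigsetU_le (disp : measure_display) (T : measurableType disp)
    (R : realType) (mu : {measure set T -> \bar R}) (I : finType) (p : pred I)
    (A : set T) (F : I -> set T) :
  measurable A -> (forall i, measurable (F i)) ->
  (forall x, A x -> exists2 i, p i & F i x) ->
  (mu A <= \sum_(i | p i) mu (F i))%E.
Proof.
move=> mA mF AF.
apply: (@le_trans _ _ (mu (\big[setU/set0]_(i | p i) F i))).
  apply: le_measure; rewrite ?inE//.
    exact: bigsetU_measurable.
  move=> x /AF[i pi Fix]; rewrite -bigcup_seq_cond/=.
  by exists i => //=; rewrite mem_index_enum.
elim: (index_enum I) => [|i s IH]; first by rewrite !big_nil measure0.
rewrite !big_cons; case: ifP => // _.
apply: le_trans (leeD2l _ IH).
by apply: measureU2 => //; apply: bigsetU_measurable.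
Qed.

Lemma bounded_density_ball (disp : measure_display)
    (Omega : measurableType disp) (R : realType) (P : probability Omega R)
    (X : {RV P >-> R}) (f : R -> R) (phi c r : R) :
  0 <= phi -> 0 < r -> bounded_density phi f -> drawn_from X f ->
  (P (X @^-1` `[(c - r)%R, (c + r)%R]) <= (phi * (2 * r))%:E)%E.
Proof.
move=> phi0 r0 [mf fphi] Xf.
have mI : measurable (`[c - r, c + r] `&` `[0, 1] : set R).
  by apply: measurableI.
have -> : P (X @^-1` `[c - r, c + r]) = distribution P X `[c - r, c + r] by [].
rewrite Xf//.
apply: (@le_trans _ _ (\int[lebesgue_measure]_(x in
    `[(c - r)%R, (c + r)%R] `&` `[0%R, 1%R]) (cst phi%:E x))%E).
  apply: ge0_le_integral => //.
  - by move=> x [_ /=]; rewrite in_itv/= => /fphi/andP[f0 _]; rewrite lee_fin.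
  - apply/measurable_EFinP; apply: measurable_funS mf => //.
  - by move=> x [_ /=]; rewrite in_itv/= => /fphi/andP[_ fl]; rewrite lee_fin.
rewrite integral_cst// EFinM lee_wpmul2l ?lee_fin//.
apply: (@le_trans _ _ (lebesgue_measure (`[c - r, c + r] : set R))).
  by apply: le_measure; rewrite ?inE.
rewrite lebesgue_measure_itv/= lte_fin; case: ifP => _; rewrite ?lee_fin; lra.
Qed.

(** * Rounding to a grid, and anti-concentration of linear forms *)

Definition grid_cell (R : realType) (M m : nat) : set R :=
  `[m%:R / M%:R, m.+1%:R / M%:R[.

Lemma grid_cellP (R : realType) (M m : nat) (x : R) : (0 < M)%N ->
  @grid_cell R M m x <-> m%:R <= M%:R * x < m.+1%:R.
Proof.
move=> M0; rewrite /grid_cell /= in_itv /= ler_pdivrMr ?ltr0n//.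
by rewrite ltr_pdivlMr ?ltr0n// mulrC.
Qed.

(** The cells are disjoint, since [m] is the integer part of [M * x] on cell [m]. *)
Lemma grid_cell_sum_le1 (disp : measure_display)
    (Omega : measurableType disp) (R : realType) (P : probability Omega R)
    (X : {RV P >-> R}) (M : nat) : (0 < M)%N ->
  \sum_(m < M.+1) fine (P (X @^-1` @grid_cell R M m)) <= 1.
Proof.
move=> M0; rewrite -lee_fin -sumEFin.
have mX m : measurable (X @^-1` @grid_cell R M m).
  by rewrite -[X @^-1` _]setTI; apply: measurable_funP => //;
    apply: measurable_itv.
under eq_bigr => m _ do rewrite fineK ?fin_num_measure//.
rewrite -(@measure_bigsetU_ord _ _ _ P M.+1 xpredT
  (fun m => X @^-1` @grid_cell R M m))//.
  by apply: probability_le1; apply: bigsetU_measurable.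
move=> m m' _ _ [w [/= /grid_cellP h /grid_cellP h']]; apply: ord_inj.
by rewrite -(truncn_def (h M0)) -(truncn_def (h' M0)).
Qed.
Lemma measurable_unit_cube (disp : measure_display)
    (Omega : measurableType disp) (R : realType) (P : probability Omega R)
    (I : finType) (X : I -> {RV P >-> R}) :
  measurable [set w | forall k, 0 <= X k w <= 1].
Proof.
rewrite (_ : mkset _ = \bigcap_(k in [set` [set: I]%SET]) (X k @^-1` `[0, 1])).
  apply: fin_bigcap_measurable => // k _.
  by rewrite -[_ @^-1` _]setTI; apply: measurable_funP.
apply/seteqP; split=> w h k; first by rewrite /= in_itv/= h.
by have := h k; rewrite /= in_itv/= inE; apply.
Qed.

Lemma measurable_preimage_itvoc (disp : measure_display)
    (T : measurableType disp) (R : realType) (g : T -> R) (a b : R) :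
  measurable_fun setT g -> measurable [set w | a < g w <= b].
Proof.
move=> mg; rewrite (_ : mkset _ = setT `&` g @^-1` `]a, b]).
  exact: mg.
by rewrite setTI; apply/seteqP; split=> w; rewrite /= in_itv.
Qed.

(** The cells are half-open, so the point 1 falls into an extra cell, the one of index [M]. *)
Lemma grid_cell_cover (R : realType) (M : nat) (x : R) :
  (0 < M)%N -> 0 <= x <= 1 -> exists m : 'I_M.+1, grid_cell M m x.
Proof.
move=> M0 /andP[x0 x1]; have Mx0 : 0 <= M%:R * x by rewrite mulr_ge0.
have tM : (Num.truncn (M%:R * x) < M.+1)%N.
  rewrite truncn_lt_nat// (le_lt_trans (ler_wpM2l _ x1))// mulr1 ltr_nat.
  exact: ltnSn.
by exists (Ordinal tM); apply/grid_cellP => //=; apply: truncn_itv.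
Qed.

Lemma grid_cell_dist (R : realType) (M m : nat) (x : R) :
  (0 < M)%N -> grid_cell M m x -> `|x - m%:R / M%:R| <= M%:R^-1.
Proof.
move=> M0 /grid_cellP -/(_ M0) /andP[lo hi].
have M0' : 0 < M%:R :> R by rewrite ltr0n.
rewrite -(ler_pM2l M0') -[X in X * `|_|]gtr0_norm// -normrM mulrBr.
rewrite mulrCA !divff ?gt_eqF// mulr1 ger0_norm; last lra.
by move: hi; rewrite -natr1; lra.
Qed.

(* Fubini is avoided: the values of all coordinates but [k0] are rounded to a
   grid so fine that the linear form moves by at most [eps]; given the grid
   cells, [X k0] is confined to an interval of length [4 * eps / `|a k0|]. *)
Lemma linear_form_anticoncentration (disp : measure_display)
    (Omega : measurableType disp) (R : realType) (P : probability Omega R)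
    (I : finType) (X : I -> {RV P >-> R}) (f : I -> R -> R) (phi eps : R)
    (a : I -> R) (k0 : I) :
  0 <= phi -> 0 < eps -> a k0 != 0 ->
  (forall k, bounded_density phi (f k)) -> (forall k, drawn_from (X k) (f k)) ->
  mutually_independent X ->
  (P [set w | (forall k, 0 <= X k w <= 1)%R /\
              (0 < \sum_k a k * X k w <= eps)%R]
   <= (phi * (4 * eps / `|a k0|))%:E)%E.
Proof.
move=> phi0 eps0 ak0 dens draw indep.
pose A := \sum_k `|a k|.
have A0 : 0 <= A by apply: sumr_ge0.
(* Rounding moves each coordinate by at most [1 / M], hence the form by at most [A / M <= eps]. *)
pose M := (Num.truncn (A / eps)).+1.
have M0 : (0 < M)%N by [].
have M0' : 0 < M%:R :> R by rewrite ltr0n.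
have AM : A / M%:R <= eps.
  by rewrite ler_pdivrMr// mulrC -ler_pdivrMr// ltW// truncnS_gt.
have nak0 : 0 < `|a k0| by rewrite normr_gt0.
(* With all coordinates but [X k0] rounded, the form lies within [2 * eps] of 0: [eps] for its exact
   value and [eps] for the rounding. *)
pose r := 2 * eps / `|a k0|.
have r0 : 0 < r by rewrite divr_gt0// mulr_gt0.
pose Y (c : {ffun I -> 'I_M.+1}) :=
  \sum_(k | k != k0) a k * ((c k)%:R / M%:R).
pose B (c : {ffun I -> 'I_M.+1}) k : set R := if k == k0 then
  `[- Y c / a k0 - r, - Y c / a k0 + r] else grid_cell M (c k).
have mB c k : measurable (B c k).
  by rewrite /B; case: ifP => _; apply: measurable_itv.
have mX k (S : set R) : measurable S -> measurable (X k @^-1` S).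
  by move=> mS; rewrite -[_ @^-1` _]setTI; apply: measurable_funP.
(* The coordinate [k0] is not rounded: its cell index is pinned to [ord0], so that it contributes a
   single factor 1 when the sum over [c] is factored. *)
pose Q k : pred 'I_M.+1 := if k == k0 then pred1 ord0 else predT.
pose F c := \bigcap_(k in [set` [set: I]%SET]) (X k @^-1` B c k).
pose G k (m : 'I_M.+1) : R := if k == k0 then 1 else
  fine (P (X k @^-1` grid_cell M m)).
have PF c : (P (F c) <= (phi * (2 * r) * \prod_k G k (c k))%:E)%E.
  rewrite /F indep// (bigD1 k0)//= (bigD1 (P := xpredT) k0)//= {1}/G eqxx mul1r.
  rewrite EFinM -prodEFin.
  have -> : (\prod_(k in [set: I]%SET | k != k0) P (X k @^-1` B c k) =
             \prod_(k | k != k0) (G k (c k))%:E)%E.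
    apply: eq_big => [k|k /andP[_ /negbTE kk0]]; first by rewrite inE.
    by rewrite /G /B kk0 fineK// fin_num_measure//; apply: mX;
      apply: measurable_itv.
  apply: lee_wpmul2r.
    rewrite prodEFin lee_fin prodr_ge0// => k _.
    by rewrite /G; case: ifP => _//; apply: fine_ge0.
  rewrite /B eqxx.
  exact: (bounded_density_ball _ phi0 r0 (dens k0) (draw k0)).
have sub w : (forall k, 0 <= X k w <= 1) -> 0 < \sum_k a k * X k w <= eps ->
    exists2 c, c \in family Q & F c w.
  move=> X01 /andP[l0 l1].
  have /choice[m mP] k := grid_cell_cover M0 (X01 k).
  pose c := [ffun k => if k == k0 then ord0 else m k] : {ffun I -> 'I_M.+1}.
  exists c.
    apply/familyP => k; rewrite /Q ffunE; case: ifP => // _; exact: eqxx.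
  move=> k _; rewrite /preimage /B /=.
  case: (eqVneq k k0) => [->|kk0]; last first.
    by rewrite ffunE (negbTE kk0).
  rewrite /= in_itv /= -ler_distlC.
  suff : `|a k0 * X k0 w + Y c| <= 2 * eps.
    apply: contraTT; rewrite -!ltNge -(ltr_pM2l nak0) [ltLHS]mulrC.
    rewrite divfK ?gt_eqF// -normrM.
    by rewrite mulrBr mulrCA divff// mulr1 -opprD normrN addrC.
  have -> : a k0 * X k0 w + Y c = \sum_k a k * X k w -
      \sum_(k | k != k0) a k * (X k w - (c k)%:R / M%:R).
    rewrite (bigD1 k0)//= -addrA -sumrB; congr (_ + _).
    by apply: eq_bigr => i _; ring.
  apply: (le_trans (ler_normB _ _)).
  have : `|\sum_(k | k != k0) a k * (X k w - (c k)%:R / M%:R)| <= A / M%:R.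
    apply: (le_trans (ler_norm_sum _ _ _)).
    rewrite /A mulr_suml [leRHS](bigD1 k0)//= -[leLHS]add0r lerD//.
    apply: ler_sum => i ik0; rewrite normrM ler_wpM2l// ffunE (negbTE ik0).
    exact: grid_cell_dist.
  by rewrite (gtr0_norm l0); lra.
have mF c : measurable (F c).
  by apply: fin_bigcap_measurable => // k _; apply: mX.
apply: (@le_trans _ _ (\sum_(c in family Q) P (F c))%E).
  apply: measure_bigsetU_le => // [|w [] /sub]; last exact.
  apply: measurableI; first exact: measurable_unit_cube.
  apply: measurable_preimage_itvoc; apply: measurable_sum => k.
  by apply: measurable_funM => //; apply: measurable_funP.
apply: (le_trans (lee_sum _ (fun c _ => PF c))).
(* The sum over cell choices of products becomes a product over coordinates of sums of cell
   probabilities, each at most 1. *)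
rewrite sumEFin lee_fin -mulr_sumr -bigA_distr_big_dep /=.
have -> : phi * (4 * eps / `|a k0|) = phi * (2 * r) * 1.
  by rewrite /r; field; rewrite gt_eqF.
rewrite ler_wpM2l//; first by rewrite !mulr_ge0// ltW.
apply: prodr_ile1 => k _; rewrite /G /Q; case: eqVneq => [_|_].
  by rewrite big_pred1_eq ler01 lexx.
by rewrite sumr_ge0 ?grid_cell_sum_le1// => m _; apply: fine_ge0.
Qed.

(** * The gain as a linear form with integer coefficients *)

Lemma sum_delta_sub (R : pzRingType) (n : nat) (x : 'I_n -> R) (u v : 'I_n) :
  \sum_i ((i == u)%:R - (i == v)%:R) * x i = x u - x v.
Proof.
have pick w : \sum_i (i == w)%:R * x i = x w.
  rewrite (bigD1 w)//= eqxx mul1r big1 ?addr0// => i /negbTE ->.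
  by rewrite mul0r.
by under eq_bigr => i _ do rewrite mulrBl; rewrite sumrB !pick.
Qed.

(* On the cell where the differences [x u1 j - x u2 j], [x v1 j - x v2 j],
   [x u1 j - x v1 j] and [x u2 j - x v2 j] have the signs prescribed by
   [sg j], the gain is the linear form with these coefficients. *)
Definition gain_coef (R : realType) (n d : nat)
    (q : 'I_n * 'I_n * 'I_n * 'I_n)
    (sg : {ffun 'I_d -> bool * bool * bool * bool}) (k : 'I_n * 'I_d) : R :=
  let: (u1, u2, v1, v2) := q in
  let: (s1, s2, s3, s4) := sg k.2 in
  (-1) ^+ s1 * ((k.1 == u1)%:R - (k.1 == u2)%:R) +
  (-1) ^+ s2 * ((k.1 == v1)%:R - (k.1 == v2)%:R) -
  (-1) ^+ s3 * ((k.1 == u1)%:R - (k.1 == v1)%:R) -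
  (-1) ^+ s4 * ((k.1 == u2)%:R - (k.1 == v2)%:R).

Lemma gain_coef_norm_ge1 (R : realType) (n d : nat)
    (q : 'I_n * 'I_n * 'I_n * 'I_n)
    (sg : {ffun 'I_d -> bool * bool * bool * bool}) (k : 'I_n * 'I_d) :
  gain_coef R q sg k != 0 -> 1 <= `|gain_coef R q sg k|.
Proof.
apply: Num.Theory.norm_intr_ge1; rewrite /gain_coef.
case: q => [[[u1 u2] v1] v2]; case: (sg k.2) => [[[s1 s2] s3] s4].
have int_sign b (x y : bool) :
    (-1) ^+ b * (x%:R - y%:R) \is a @Num.int R.
  by rewrite rpredM ?rpredB ?rpredX ?rpredN1 ?rpred_nat.
by rewrite !rpredB ?rpredD.
Qed.

(** Each absolute value is its argument times a sign. The pattern [sg] depends on the point [x], so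
    a probability bound has to sum over all patterns. *)
Lemma gain_linear (R : realType) (n d : nat) (x : 'I_n -> 'I_d -> R)
    (q : 'I_n * 'I_n * 'I_n * 'I_n) :
  exists sg, gain (fun i i' => manhattan (\row_j x i j) (\row_j x i' j)) q =
    \sum_k gain_coef R q sg k * x k.1 k.2.
Proof.
case: q => [[[u1 u2] v1] v2].
pose sg : {ffun 'I_d -> bool * bool * bool * bool} :=
  [ffun j => (x u1 j - x u2 j < 0, x v1 j - x v2 j < 0,
              x u1 j - x v1 j < 0, x u2 j - x v2 j < 0)].
exists sg; rewrite (_ : \sum_k _ =
  \sum_i \sum_j gain_coef R (u1, u2, v1, v2) sg (i, j) * x i j); last first.
  by rewrite pair_bigA; apply: eq_bigr => -[].
rewrite exchange_big /= /gain /manhattan -!big_split /= -!sumrB.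
apply: eq_bigr => j _; rewrite !mxE !normrEsign.
under [RHS]eq_bigr => i _ do
  rewrite /gain_coef /= ffunE 2!mulrBl mulrDl -!mulrA.
by rewrite !sumrB big_split /= -!mulr_sumr !(sum_delta_sub (x^~ j)).
Qed.

Lemma gain_small_probability (disp : measure_display)
    (Omega : measurableType disp) (R : realType) (P : probability Omega R)
    (n d : nat) (X : 'I_n -> 'I_d -> {RV P >-> R})
    (f : 'I_n -> 'I_d -> R -> R) (phi eps : R)
    (q : 'I_n * 'I_n * 'I_n * 'I_n) :
  0 <= phi -> 0 < eps ->
  (forall i j, bounded_density phi (f i j)) ->
  (forall i j, drawn_from (X i j) (f i j)) ->
  mutually_independent (fun ij : 'I_n * 'I_d => X ij.1 ij.2) ->
  let A := [set w | (forall ij : 'I_n * 'I_d, 0 <= X ij.1 ij.2 w <= 1)%R /\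
    (0 < gain (fun i i' => manhattan (\row_j X i j w) (\row_j X i' j w)) q
       <= eps)%R] in
  measurable A /\ (P A <= (16 ^+ d * (4 * phi * eps))%:E)%E.
Proof.
move=> phi0 eps0 dens draw indep A.
have mA : measurable A.
  apply: measurableI; first exact: measurable_unit_cube.
  apply: measurable_preimage_itvoc.
  have mdist i i' : measurable_fun setT
      (fun w => manhattan (\row_j X i j w) (\row_j X i' j w)).
    rewrite /manhattan; under eq_fun do under eq_bigr do rewrite !mxE.
    apply: measurable_sum => j; apply: measurableT_comp => //.
    by apply: measurable_funB; apply: measurable_funP.
  case: q {A} => [[[u1 u2] v1] v2]; rewrite /gain.
  by do 2![apply: measurable_funB => //]; apply: measurable_funD.
split=> //.
pose lin sg w := \sum_k gain_coef R q sg k * X k.1 k.2 w.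
pose F sg := [set w | (forall k : 'I_n * 'I_d, 0 <= X k.1 k.2 w <= 1)%R /\
  (0 < lin sg w <= eps)%R].
have mF sg : measurable (F sg).
  apply: measurableI; first exact: measurable_unit_cube.
  apply: measurable_preimage_itvoc; apply: measurable_sum => k.
  by apply: measurable_funM => //; apply: measurable_funP.
pose nz sg := [exists k : 'I_n * 'I_d, gain_coef R q sg k != 0].
apply: (@le_trans _ _ (\sum_(sg | nz sg) P (F sg))%E).
  apply: measure_bigsetU_le => // w [w01].
  have [sg ->] := gain_linear (fun i j => X i j w) q => lw.
  exists sg; last by split.
  apply: contraLR lw => /existsPn z.
  (* A pattern whose coefficients all vanish would make the gain 0, contrary to its positivity. *)
  by rewrite big1 ?ltxx// => k _; have /eqP -> := negPn (z k); rewrite mul0r.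
apply: (@le_trans _ _ (\sum_(sg | nz sg) (4 * phi * eps)%:E)%E).
  apply: lee_sum => sg /existsP[k0 nk0].
  apply: (le_trans (linear_form_anticoncentration phi0 eps0 nk0
    (fun k => dens k.1 k.2) (fun k => draw k.1 k.2) indep)).
  rewrite lee_fin [4 * phi]mulrC -[leRHS]mulrA ler_wpM2l// ler_pdivrMr.
    by rewrite ler_peMr ?gain_coef_norm_ge1// mulr_ge0// ltW.
  exact: lt_le_trans ltr01 (gain_coef_norm_ge1 nk0).
rewrite sumEFin lee_fin sumr_const -[leLHS]mulr_natl ler_wpM2r//.
  by rewrite !mulr_ge0// ltW.
apply: (@le_trans _ _ (#|{: {ffun 'I_d -> bool * bool * bool * bool}}|%:R)).
  by rewrite ler_nat max_card.
(* Four signs for each of the [d] coordinates give [16 ^ d] patterns. *)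
by rewrite card_ffun !card_prod card_bool card_ord natrX.
Qed.

(** * Harmonic sums and the expected number of steps *)

(** This is [ln (1 + y) <= y] at [y = 1 / x - 1]. *)
Lemma ln_ge_one_sub_inv (R : realType) (x : R) : 0 < x -> 1 - x^-1 <= ln x.
Proof.
move=> x0; have xV0 : 0 < x^-1 by rewrite invr_gt0.
have := @le_ln1Dx R (x^-1 - 1); rewrite [1 + _]addrC subrK lnV ?posrE//.
by move=> /(_ ltac:(lra)); lra.
Qed.

Lemma harmonic_sum_le_ln (R : realType) (N : nat) : (0 < N)%N ->
  \sum_(t < N) (t.+1%:R : R)^-1 <= 1 + ln N%:R.
Proof.
elim: N => [//|[|N] IH _]; first by rewrite big_ord1 invr1 ln1 addr0.
rewrite big_ord_recr /=; have := IH isT; move: (\sum_(i < N.+1) _) => S.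
have N1 : 0 < N.+1%:R :> R by rewrite ltr0n.
have N2 : 0 < N.+2%:R :> R by rewrite ltr0n.
have := @ln_ge_one_sub_inv R (N.+2%:R / N.+1%:R) (divr_gt0 N2 N1).
rewrite ln_div ?posrE// invf_div.
have -> : 1 - N.+1%:R / N.+2%:R = (N.+2%:R : R)^-1.
  rewrite -[X in X - _](divff (lt0r_neq0 N2)) -mulrBl -natrB// subSnn.
  by rewrite mul1r.
by move=> h1 h2; apply: le_trans (lerD h2 h1) _; rewrite -addrA subrKC.
Qed.

Lemma manhattan_unit_cube (R : realType) (n d : nat) (x : 'I_n -> 'I_d -> R)
    (i i' : 'I_n) :
  (forall ij : 'I_n * 'I_d, 0 <= x ij.1 ij.2 <= 1) ->
  0 <= manhattan (\row_j x i j) (\row_j x i' j) <= d%:R.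
Proof.
move=> x01; rewrite /manhattan sumr_ge0//=.
rewrite -[leRHS](_ : \sum_(j < d) 1 = _); last by rewrite sumr_const card_ord.
apply: ler_sum => j _; rewrite !mxE ler_norml.
by have /= := x01 (i, j); have /= := x01 (i', j); lra.
Qed.

Lemma manhattan_sym (R : realType) (d : nat) (x y : 'rV[R]_d) :
  manhattan x y = manhattan y x.
Proof. by apply: eq_bigr => j _; rewrite distrC. Qed.

(** [drawn_from] integrates over the part of [A] inside [0, 1] only, so each coordinate leaves this
    interval with probability 0. *)
Lemma outside_unit_cube_null (disp : measure_display)
    (Omega : measurableType disp) (R : realType) (P : probability Omega R)
    (I : finType) (X : I -> {RV P >-> R}) (f : I -> R -> R) :
  (forall k, drawn_from (X k) (f k)) ->
  P (~` [set w | forall k, 0 <= X k w <= 1]) = 0%E.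
Proof.
move=> draw; apply/eqP; rewrite eq_le measure_ge0 andbT.
have mC : measurable (~` `[0, 1] : set R) by apply: measurableC.
have null k : P (X k @^-1` (~` `[0, 1])) = 0%E.
  rewrite -[LHS]/(distribution P (X k) (~` `[0, 1])) draw//.
  by rewrite setICl integral_set0.
apply: (@le_trans _ _ (\sum_(k in I) P (X k @^-1` (~` `[0%R, 1%R])))%E).
  apply: measure_bigsetU_le => [|k|w].
  - by apply: measurableC; apply: measurable_unit_cube.
  - by rewrite -[_ @^-1` _]setTI; apply: measurable_funP.
  - by move=> /existsNP[k wk]; exists k => //=; rewrite in_itv.
by rewrite big1.
Qed.

(** A 2-change displays four entries of an [n]-tuple, so no step is possible here. *)
Lemma two_opt_steps_small (R : realType) (n : nat)
    (dist : 'I_n -> 'I_n -> R) : (n < 4)%N -> (two_opt_steps dist <= 0)%E.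
Proof.
move=> n4; apply: ge_ereal_sup => _ [s [E [_ ps _]] <-].
case: s ps => [|F s] //= /andP[/asboolP[]].
case=> t [u1 [u2 [v1 [v2 [p [q [_ _ et _]]]]]]].
have := size_tuple t; rewrite et /= size_cat /= => n_eq.
suff : (4 <= n)%N by rewrite leqNgt n4.
by rewrite -[leqRHS]n_eq !addnS.
Qed.
Theorem theorem5 (R : realType) (d : nat) (hd : (2 <= d)%N) :
  exists2 C : R, 0 < C &
    forall (n : nat) (phi : R), 1 <= phi ->
    forall (disp : measure_display) (Omega : measurableType disp)
      (P : probability Omega R)
      (X : 'I_n -> 'I_d -> {RV P >-> R}) (f : 'I_n -> 'I_d -> R -> R),
    (forall i j, bounded_density phi (f i j)) ->
    (forall i j, drawn_from (X i j) (f i j)) ->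
    mutually_independent (fun ij : 'I_n * 'I_d => X ij.1 ij.2) ->
    (\int[P]_omega two_opt_steps (fun i i' : 'I_n =>
        manhattan (\row_(j < d) X i j omega) (\row_(j < d) X i' j omega))
     <= (C * n%:R ^+ 6 * ln n%:R * phi)%:E)%E.
Proof.
have d0 : 0 < d%:R :> R by rewrite ltr0n (leq_trans _ hd).
(* The 8 is 4 from the anti-concentration bound times 2 from [1 + n ln n <= 2 n ln n]; [16 ^ d]
   counts sign patterns, and [d] comes from the length bound [n * d]. *)
exists (8 * 16 ^+ d * d%:R); first by rewrite !mulr_gt0// exprn_gt0.
move=> n phi phi1 disp Omega P X f dens draw indep.
have phi0 : 0 <= phi := le_trans ler01 phi1.
(* For [n <= 1] the right-hand side is 0 ([ln 0] is 0 by convention), so the expectation must be at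
   most 0. *)
have [n1|n1] := leqP n 1.
  apply: (@le_trans _ _ (\int[P]_omega (cst 0%E omega))%E).
    apply: le_integral_ge0_bound => // w.
    by apply: two_opt_steps_small; apply: leq_ltn_trans n1 _.
  by rewrite integral_cst// mul0e lee_fin; case: n n1 {X f dens draw indep} =>
    [|[|//]] _; rewrite ?ln1 ?ln0 ?mulr0 ?mul0r.
have n0 : 0 < n%:R :> R by rewrite ltr0n ltnW.
pose dist w (i i' : 'I_n) :=
  manhattan (\row_(j < d) X i j w) (\row_(j < d) X i' j w).
pose N := (n ^ n)%N.
have N0 : (0 < N)%N by rewrite expn_gt0 ltnW.
pose cube := [set w | forall ij : 'I_n * 'I_d, 0 <= X ij.1 ij.2 w <= 1].
pose eps (t : nat) : R := n%:R * d%:R / t.+1%:R.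
have eps0 t : 0 < eps t by rewrite divr_gt0 ?mulr_gt0// ltr0n.
pose small t q := [set w | cube w /\ (0 < gain (dist w) q <= eps t)%R].
have small_prob t q := gain_small_probability q phi0 (eps0 t) dens draw indep.
have mcube : measurable cube := measurable_unit_cube _.
have Pcube : P (~` cube) = 0%E.
  exact: outside_unit_cube_null (fun k : 'I_n * 'I_d => draw k.1 k.2).
(* A measurable event containing every outcome that admits a run of at least [t.+1] steps. The null
   set outside the cube is included because distances are bounded by [d] only inside it. *)
pose A t := ~` cube `|` \big[setU/set0]_q small t q.
have msmall t : measurable (\big[setU/set0]_q small t q).
  by apply: bigsetU_measurable => q _; have [] := small_prob t q.
have mA t : measurable (A t).
  by apply: measurableU => //; apply: measurableC.
pose K : R := n%:R ^+ 4 * (16 ^+ d * (4 * phi * (n%:R * d%:R))).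
have PA t : (P (A t) <= (K / t.+1%:R)%:E)%E.
  apply: le_trans (measureU2 _ _ _) _ => //; first exact: measurableC.
  rewrite [X in (X + _)%E]Pcube add0e.
  apply: (@le_trans _ _ (\sum_q P (small t q))%E).
    apply: measure_bigsetU_le => // [q|w]; first by have [] := small_prob t q.
    by rewrite -bigcup_seq_cond/= => -[q _ ?]; exists q.
  apply: (le_trans (lee_sum _ (fun q _ => proj2 (small_prob t q)))).
  rewrite sumEFin lee_fin sumr_const !card_prod card_ord -[leLHS]mulr_natl.
  by rewrite !natrM /K /eps le_eqVlt; apply/orP; left; apply/eqP; field.
(* Tail-sum bound: a run [s] counts 1 for each [t < size s], and [A t] holds for all these [t]. *)
pose g w : R := \sum_(t < N) \1_(A t) w.
have steps_le w : (two_opt_steps (dist w) <= (g w)%:E)%E.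
  apply: ge_ereal_sup => _ [s [E run] <-]; rewrite lee_fin.
  have sN : (size s <= N)%N.
    by have [_ ps _] := run; apply: improving_path_size ps.
  have -> : (size s)%:R = \sum_(t < size s) 1 :> R.
    by rewrite sumr_const card_ord.
  rewrite (big_ord_widen N (fun=> 1))// big_mkcond /=.
  apply: ler_sum => t _; case: ifP => [ts|_]; last by rewrite indicE.
  rewrite indicE mem_set//.
  have [cw|ncw] := pselect (cube w); last by left.
  right; rewrite -bigcup_seq_cond/=.
  have [||q qw] :=
    @two_opt_run_small_gain _ _ (dist w) d%:R _ _ t.+1 _ _ run ts.
  - by move=> i j; apply: manhattan_sym.
  - by move=> i j; apply: (manhattan_unit_cube (x := fun i j => X i j w)).
  - by exists q => //=; rewrite mem_index_enum.
have g0 w : (0 <= (g w)%:E)%E by rewrite lee_fin sumr_ge0.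
apply: (le_trans (le_integral_ge0_bound P g0 steps_le)).
have -> : (\int[P]_w (g w)%:E = \sum_(t < N) P (A t))%E.
  under eq_integral do rewrite /g -sumEFin.
  rewrite ge0_integral_sum//.
    by apply: eq_bigr => t _; rewrite integral_indic// setIT.
  by move=> t; apply/measurable_EFinP; apply: measurable_indic.
apply: (le_trans (lee_sum _ (fun (t : 'I_N) _ => PA t))).
rewrite sumEFin lee_fin -mulr_sumr.
have K0 : 0 <= K by rewrite /K !mulr_ge0// ?exprn_ge0// ltW.
apply: (le_trans (ler_wpM2l K0 (harmonic_sum_le_ln R N0))).
rewrite /N natrX lnXn// -[X in 1 + X]mulr_natl.
(* From [ln n >= 1 - 1 / n] one gets [n ln n >= n - 1 >= 1], which absorbs the 1 of the harmonic
   bound. *)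
have nln : 1 <= n%:R * ln n%:R :> R.
  apply: (@le_trans _ _ (n%:R * (1 - n%:R^-1))); last first.
    by rewrite (ler_wpM2l (ltW n0))// ln_ge_one_sub_inv.
  rewrite mulrBr mulr1 divff ?gt_eqF// -[X in _ - X]/(1%:R) -natrB ?(ltnW n1)//.
  by rewrite ler1n subn_gt0.
apply: (@le_trans _ _ (K * (2 * (n%:R * ln n%:R)))).
  by rewrite ler_wpM2l// [2 * _]mulr_natl mulr2n lerD2r.
by rewrite /K le_eqVlt; apply/orP; left; apply/eqP; ring.
Qed.
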